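(* Let $\mathcal{G}$ be a directed graph on vertex set $\{1,\dots,n\}$ with adjacency matrix $A\in\{0,1\}^{n\times n}$, and assume that $A$ is diagonalizable over $\mathbb{C}$. Let $\beta\neq 0$ be an algebraic number. If two vertices $i,j$ are $\beta$-subgraph equivalent, i.e. $[e^{\beta A}]_{ii}=[e^{\beta A}]_{jj}$, then $i$ and $j$ are cospectral, i.e. $[A^r]_{ii}=[A^r]_{jj}$ for every integer $r>0$.
   Context: The adjacency matrix $A$ has $A_{ij}=1$ if there is a (directed) edge from $i$ to $j$ and $A_{ij}=0$ otherwise; undirected graphs are included as the case of symmetric $A$. A complex number is algebraic if it is a root of a nonzero polynomial with rational coefficients. $e^{\beta A}$ denotes the matrix exponential. *)

(* Defs.v *)
From HB Require Import structures.
From mathcomp Require Import all_boot all_order all_algebra.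
From mathcomp Require Import all_classical all_reals.
From mathcomp Require Import topology normedtype sequences.
From mathcomp Require Import complex.

Set Implicit Arguments.
Unset Strict Implicit.
Unset Printing Implicit Defensive.

Import Order.TTheory GRing.Theory Num.Theory.
Import numFieldNormedType.Exports.

Local Open Scope classical_set_scope.
Local Open Scope ring_scope.

(* A digraph on n vertices is an arbitrary relation e on 'I_n (loops allowed),
   so that its adjacency matrix is an arbitrary 0-1 matrix. *)
Definition adjmx (K : numFieldType) (n : nat) (e : rel 'I_n) : 'M[K]_n :=
  \matrix_(i, j) (e i j)%:R.

(* The limit is taken in the canonical (sup-norm) topology of 'M[K]_n. It is
   the usual exponential for K = R[i] with R : realType, where the series
   converges; over an incomplete K, lim may return an arbitrary value. *)
Definition expmx (K : numFieldType) (n : nat) (M : 'M[K]_n) : 'M[K]_n :=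
  limn (series (fun k : nat => (k`!%:R)^-1 *: M ^+ k)).

Definition subgraph_equivalent (K : numFieldType) (n : nat) (beta : K)
    (A : 'M[K]_n) (i j : 'I_n) : Prop :=
  expmx (beta *: A) i i = expmx (beta *: A) j j.

Definition cospectral (K : numFieldType) (n : nat) (A : 'M[K]_n)
    (i j : 'I_n) : Prop :=
  forall r : nat, (0 < r)%N -> (A ^+ r) i i = (A ^+ r) j j.

(* Main.v *)
Require Import Defs.
From HB Require Import structures.
From mathcomp Require Import all_boot all_order all_algebra.
From mathcomp Require Import separable ring zify.

(* Write c_k, lam_k for the coefficients and eigenvalues with
   u_r = [A^r]_ii - [A^r]_jj = sum_k c_k lam_k^r, which are integers; the
   hypothesis says that f(x) = sum_k c_k e^(lam_k x) vanishes at beta.  Let a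
   be a nonzero integer such that a beta is an algebraic integer, with
   conjugates gam_m.  The product F(x) = prod_m f(gam_m x) is again an
   exponential sum with algebraic integer exponents mu_k, its Taylor
   coefficients U_r / r! have integer U_r by symmetry in the gam_m, and
   F(1/a) = 0.

   For a polynomial q put L(q) = sum_s a^s sum_k c_k q^(s)(mu_k), Hermite's
   functional.  F(1/a) = 0 gives |L(X^r)| <= K M^r, while n! divides
   L(X^r P^n) when P is a monic integer polynomial killing all mu_k.  Hence
   L(X^r P^n) = 0 for r < n and n large, then L vanishes on the ideal of
   P^n, then on that of a power of the radical of P, and finally, as
   L(q) = sum_k c_k q(mu_k) + a L(q'), everywhere.  So U = 0, and comparing
   lowest coefficients u = 0. *)

Set Implicit Arguments.
Unset Strict Implicit.
Unset Printing Implicit Defensive.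

Import Order.TTheory GRing.Theory Num.Theory.

Local Open Scope ring_scope.

(** * The Hermite functional *)

Lemma expn_leq_fact (b m : nat) : (b ^ m <= (b + m)`!)%N.
Proof.
elim: m => [|m IHm]; first by rewrite expn0 fact_gt0.
by rewrite expnS addnS factS leq_mul // ltnW // ltnS leq_addr.
Qed.

Lemma fact_dominates_exp (K a : nat) :
  exists n0, forall n, (n0 <= n)%N -> (K * a ^ n < n`!)%N.
Proof.
(* Past [b], each factor of the factorial of [n] exceeds [2 * a.+1]: the powers of [a.+1] match, and
   the surplus [2 ^ m] beats [m >= K * a.+1 ^ b]. *)
pose b := (a.+1).*2; exists (b + K * a.+1 ^ b)%N => n le_n.
have le_bn : (b <= n)%N by apply: leq_trans le_n; apply: leq_addr.
rewrite -(subnKC le_bn); set m := (n - b)%N.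
have le_m : (K * a.+1 ^ b <= m)%N by rewrite leq_subRL.
have le_aS k : (a ^ k <= a.+1 ^ k)%N by case: k => // k; rewrite leq_exp2r.
apply: (@leq_ltn_trans (K * a.+1 ^ (b + m))); first by rewrite leq_mul.
apply: leq_trans (expn_leq_fact b m).
have -> : (b ^ m = 2 ^ m * a.+1 ^ m)%N by rewrite -expnMn mul2n.
rewrite expnD mulnA ltn_pmul2r ?expn_gt0 //.
by apply: leq_ltn_trans le_m _; apply: ltn_expl.
Qed.

(** Each differentiation costs at most one factor [P]; for [s >= n] the truncated exponent is
    [0]. *)
Lemma dvdp_exp_derivn (F : fieldType) (P Q : {poly F}) (n s : nat) :
  P ^+ (n - s) %| (P ^+ n * Q)^`(s).
Proof.
elim: s => [|s IHs]; first by rewrite subn0 derivn0 dvdp_mulr.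
rewrite derivnS subnS; case: (n - s)%N IHs => [|k] IHs /=.
  by rewrite expr0 dvd1p.
have [T ->] := dvdpP _ _ IHs.
rewrite derivM deriv_exp /= -mulrnAl exprS mulrA [T * _]mulrA -mulrDl.
exact: dvdp_mulIr.
Qed.

Section Hermite.
Variables (C : numClosedFieldType) (I : finType) (c mu : I -> C) (D : C).

Definition exp_eval (q : {poly C}) : C := \sum_k c k * q.[mu k].

(** At each node [x = mu k], the sum over [s] is the integral of [e^(-t) q(x + D t)] over [t >= 0].
    The cut at [size q] loses nothing, since higher derivatives vanish. *)
Definition hermite (q : {poly C}) : C :=
  \sum_(s < size q) D ^+ s * exp_eval q^`(s).

Fact exp_eval_is_linear : linear_for *%R exp_eval.
Proof.
move=> a p q; rewrite /exp_eval /= mulr_sumr -big_split /=; apply: eq_bigr => k _.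
by rewrite hornerD hornerZ mulrDr mulrCA.
Qed.
HB.instance Definition _ :=
  GRing.isLinear.Build C {poly C} C *%R exp_eval exp_eval_is_linear.

Lemma hermiteE (N : nat) (q : {poly C}) : (size q <= N)%N ->
  hermite q = \sum_(s < N) D ^+ s * exp_eval q^`(s).
Proof.
move=> leN; rewrite /hermite (big_ord_widen _ (fun s => D ^+ s * exp_eval q^`(s)) leN).
rewrite big_mkcond; apply: eq_bigr => s _; case: ltnP => // le_s.
by rewrite derivn_poly0 // linear0 mulr0.
Qed.

Fact hermite_is_linear : linear_for *%R hermite.
Proof.
move=> a p q; suff: hermite (a *: p + q) = a * hermite p + hermite q by [].
pose N := maxn (size (a *: p + q)) (maxn (size p) (size q)).
have leN1 : (size (a *: p + q)%R <= N)%N by rewrite leq_maxl.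
have leN2 : (size p <= N)%N by rewrite /N !leq_max leqnn orbT.
have leN3 : (size q <= N)%N by rewrite /N !leq_max leqnn !orbT.
rewrite (hermiteE leN1) (hermiteE leN2) (hermiteE leN3).
rewrite big_distrr -big_split /=.
apply: eq_bigr => s _.
by rewrite linearP linearP /= mulrDr mulrCA.
Qed.
HB.instance Definition _ :=
  GRing.isLinear.Build C {poly C} C *%R hermite hermite_is_linear.

Lemma hermite_rec (q : {poly C}) :
  hermite q = exp_eval q + D * hermite q^`().
Proof.
rewrite (@hermiteE (size q).+1) // big_ord_recl expr0 mul1r derivn0; congr (_ + _).
have le_size : (size q^`() <= size q)%N by exact: leq_trans (size_poly _ _) (leq_pred _).
rewrite (hermiteE le_size) mulr_sumr; apply: eq_bigr => s _.
by rewrite lift0 derivSn exprS mulrA.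
Qed.

Lemma exp_eval_root (P Q : {poly C}) :
  (forall k, root P (mu k)) -> P %| Q -> exp_eval Q = 0.
Proof.
move=> rP /dvdpP[T ->]; rewrite /exp_eval big1 // => k _.
by rewrite hornerM (rootP (rP k)) !mulr0.
Qed.

(* From [hermite_rec], if the functional kills the ideal of [P ^+ n.+1] then
   it kills [P ^+ n * P^`()], hence [P ^+ n] by a Bezout relation. *)
Lemma hermite_separable_descent (P : {poly C}) (n : nat) :
  D != 0 -> separable_poly P ->
  (forall k, root P (mu k)) ->
  (forall Q, hermite (P ^+ n * Q) = 0) -> forall Q, hermite Q = 0.
Proof.
move=> D0 sepP rP; elim: n => [|n IHn] vanish.
  by move=> Q; rewrite -[Q]mul1r -(expr0 P).
apply: IHn => Q.
have vanish' T : hermite (P ^+ n * P^`() * T) = 0.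
  have := hermite_rec (P ^+ n.+1 * T); rewrite vanish.
  rewrite (exp_eval_root rP); last by rewrite exprS -mulrA dvdp_mulr.
  rewrite add0r derivM deriv_exp /= linearD /= vanish addr0 => /esym/eqP.
  rewrite mulf_eq0 (negPf D0) /= mulrnAl linearMn /= -mulr_natr mulf_eq0.
  rewrite pnatr_eq0 orbF => /eqP <-.
  by rewrite (mulrC P^`()).
move: sepP; rewrite unlock => /Bezout_eq1_coprimepP[[A B] /= bezout].
rewrite -[Q]mul1r -bezout mulrDl mulrDr linearD /=.
rewrite (_ : _ * (A * P * Q) = P ^+ n.+1 * (A * Q)); last by rewrite exprSr; ring.
rewrite (_ : _ * (B * _ * Q) = P ^+ n * P^`() * (B * Q)); last by ring.
by rewrite vanish vanish' addr0.
Qed.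

Lemma exp_eval_int (u : nat -> int) (q : {poly int}) :
  (forall r, exp_eval 'X^r = (u r)%:~R) ->
  exists z : int, exp_eval (map_poly intr q) = z%:~R.
Proof.
move=> uE; exists (\sum_(i < size q) q`_i * u i).
rewrite -{1}[q]coefK poly_def !rmorph_sum linear_sum /=; apply: eq_bigr => i _.
by rewrite map_polyZ map_polyXn linearZ /= uE rmorphM.
Qed.

End Hermite.

(** * Divisibility and size of the Hermite functional *)

Section IntegralHermite.
Variables (C : numClosedFieldType) (I : finType) (c mu : I -> C) (d : int).
Variable u : nat -> int.
Hypothesis uE : forall r, exp_eval c mu 'X^r = (u r)%:~R.
Local Notation pZtoC := (map_poly (intr : int -> C)).
Local Notation L := (hermite c mu d%:~R).

(* Derivatives of order [s < n] of [P ^+ n * Q] vanish at every [mu k], and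
   those of order [s >= n] have coefficients divisible by [s`!]. *)
Lemma fact_dvd_hermite (P Q : {poly int}) (n : nat) :
  (forall k, root (pZtoC P) (mu k)) ->
  exists z : int, L (pZtoC (P ^+ n * Q)) = n`!%:R * z%:~R.
Proof.
move=> rP; rewrite /hermite.
elim/big_ind: _ => [|x y [z1 ->] [z2 ->]|s _].
- by exists 0; rewrite mulr0.
- by exists (z1 + z2); rewrite rmorphD mulrDr.
case: s => s /= _; have [lt_sn|le_ns] := ltnP s n.
  exists 0; rewrite mulr0 (exp_eval_root _ rP) ?mulr0 //.
  rewrite rmorphM rmorphXn /=; apply: dvdp_trans (dvdp_exp_derivn _ _ _ _).
  by rewrite -(prednK (n := n - s)) ?subn_gt0 // exprS dvdp_mulr.
have [z Lz] := exp_eval_int (P ^+ n * Q)^`N(s) uE.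
(* The [s]-th derivative is the factorial of [s] times an integral divided derivative; the falling
   factorial is the quotient of the factorials of [s] and [n]. *)
exists (d ^+ s * z * (s ^_ (s - n))%:R).
rewrite derivn_map nderivn_def rmorphMn /= linearMn /= Lz.
have -> : s`! = (s ^_ (s - n) * n`!)%N by rewrite -{2}(subKn le_ns) ffact_fact ?leq_subr.
rewrite -(mulr_natr z%:~R) natrM !rmorphM rmorphXn /= rmorph_nat; ring.
Qed.

(** Peeling off one factor [P] raises the exponent [r] by [i] at the [i]-th coefficient, at a cost
    of [M ^ i]; hence the base is [P] with absolute coefficients, evaluated at [M]. *)
Lemma norm_hermite_le (P : {poly int}) (K M : nat) :
  (forall r, `|L 'X^r| <= (K * M ^ r)%:R) ->
  forall n r, `|L ('X^r * pZtoC (P ^+ n))| <=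
    (K * M ^ r * (\sum_(i < size P) `|(P`_i)%R|%N * M ^ i) ^ n)%:R.
Proof.
move=> LX; elim=> [|n IHn] r; first by rewrite rmorph1 mulr1 expn0 muln1 LX.
rewrite exprS rmorphM /= mulrA -[in pZtoC P](coefK P) poly_def rmorph_sum /=.
rewrite mulr_sumr mulr_suml linear_sum /=; apply: le_trans (ler_norm_sum _ _ _) _.
rewrite expnS mulnA big_distrr big_distrl /= natr_sum; apply: ler_sum => i _.
rewrite map_polyZ map_polyXn -scalerAr -scalerAl linearZ /= -exprD normrM.
apply: le_trans (ler_wpM2l (normr_ge0 _) (IHn _)) _.
rewrite -intr_norm -abszE pmulrn -natrM ler_nat expnD leq_eqVlt; apply/orP; left.
by apply/eqP; ring.
Qed.

(** An integer multiple of the factorial of [n] that is smaller in absolute value is zero. The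
    condition [r < n] keeps the bound exponential in [n]; the base [M.+1] makes it monotone in the
    exponent. *)
Lemma hermite_eq0_small (P : {poly int}) (K M : nat) :
  (forall k, root (pZtoC P) (mu k)) ->
  (forall r, `|L 'X^r| <= (K * M.+1 ^ r)%:R) ->
  exists n0, forall n r, (n0 <= n)%N -> (r < n)%N ->
    L ('X^r * pZtoC (P ^+ n)) = 0.
Proof.
move=> rP LX; set B := (\sum_(i < size P) `|(P`_i)%R|%N * M.+1 ^ i)%N.
have [n0 n0P] := fact_dominates_exp K (M.+1 * B); exists n0 => n r le_n lt_r.
have := norm_hermite_le P LX n r; rewrite -/B.
have [z] := fact_dvd_hermite 'X^r n rP.
rewrite rmorphM /= map_polyXn mulrC => ->.
rewrite normrM normr_nat -intr_norm -abszE pmulrn -natrM ler_nat => le_z.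
have : (n`! * `|z| < n`!)%N.
  apply: (leq_ltn_trans le_z); apply: leq_ltn_trans (n0P _ le_n).
  by rewrite expnMn mulnA leq_mul // leq_mul // leq_pexp2l // ltnW.
by rewrite -{2}[n`!]muln1 ltn_pmul2l ?fact_gt0 // ltnS leqn0 absz_eq0 => /eqP->; rewrite mulr0.
Qed.

(* Downward induction on [n]: a monic [P] lets one trade ['X^r * P ^+ n] for
   ['X^(r - deg P) * P ^+ n.+1] plus lower values of [r]. *)
Lemma hermite_eq0_ideal (P : {poly int}) (n0 : nat) : P \is monic ->
  (forall n r, (n0 <= n)%N -> (r < n)%N -> L ('X^r * pZtoC (P ^+ n)) = 0) ->
  forall Q, L (Q * pZtoC (P ^+ maxn n0 (size P))) = 0.
Proof.
move=> monP small; set n1 := maxn _ _.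
suff LX r : L ('X^r * pZtoC (P ^+ n1)) = 0.
  move=> Q; rewrite -[Q]coefK poly_def mulr_suml linear_sum big1 //= => i _.
  by rewrite -scalerAl linearZ /= LX mulr0.
(* At [n = N] every exponent below [N] is covered by [small], so the descent starts there; [m] is
   the distance to [N]. *)
have [N lt_rN le_n1N] : exists2 N, (r < N)%N & (n1 <= N)%N.
  by exists (maxn r.+1 n1); rewrite ?leq_maxl ?leq_maxr.
suff down n m : (n1 <= n)%N -> (n + m = N)%N ->
    forall r, (r < N)%N -> L ('X^r * pZtoC (P ^+ n)) = 0.
  apply: (down n1 (N - n1)%N) => //; exact: subnKC.
elim: m n => [|m IHm] n le_n nmN {lt_rN}r.
  by rewrite -nmN addn0; apply: small; apply: leq_trans le_n; apply: leq_maxl.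
elim/ltn_ind: r => r IHr lt_r.
have [lt_rn|le_nr] := ltnP r n.
  by apply: small => //; apply: leq_trans le_n; apply: leq_maxl.
set e := (size P).-1; have szP : size P = e.+1.
  by rewrite prednK // size_poly_gt0 monic_neq0.
(* Here [n1 >= size P] matters: an exponent [r >= n] leaves room for a division by [P]. *)
have le_er : (e <= r)%N.
  apply: leq_trans le_nr; apply: leq_trans le_n; apply: leq_trans (leq_maxr _ _).
  exact: leq_pred.
have PE : 'X^e = P - \sum_(i < e) P`_i *: 'X^i.
  rewrite -{1}[P]coefK poly_def szP big_ord_recr /= addrC addrK.
  by move/monicP: monP; rewrite lead_coefE -/e => ->; rewrite scale1r.
have -> : 'X^r * pZtoC (P ^+ n) = 'X^(r - e) * pZtoC (P ^+ n.+1)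
    - \sum_(i < e) (P`_i)%:~R *: ('X^(r - e + i) * pZtoC (P ^+ n)).
  rewrite -{1}(subnK le_er) exprD -(map_polyXn (intr : {rmorphism int -> C}) e) PE.
  rewrite rmorphB rmorph_sum /= mulrBr mulrBl exprS rmorphM /= mulrA; congr (_ - _).
  rewrite mulr_sumr mulr_suml; apply: eq_bigr => i _.
  by rewrite map_polyZ map_polyXn -scalerAr -scalerAl exprD.
have lt_sub_N : (r - e < N)%N by apply: leq_ltn_trans lt_r; apply: leq_subr.
rewrite linearB /= (IHm n.+1) ?addSnnS ?leqW // sub0r; apply/eqP; rewrite oppr_eq0.
rewrite (linear_sum (hermite _ _ _)) /=; apply/eqP/big1 => i _.
have lt_ir : (r - e + i < r)%N by rewrite -[X in (_ < X)%N](subnK le_er) ltn_add2l.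
rewrite linearZ /= IHr ?mulr0 //; apply: leq_ltn_trans lt_r.
by rewrite -[X in (_ <= X)%N](subnK le_er) leq_add2l ltnW.
Qed.

Lemma integral_exp_coef_eq0 (K M : nat) : d != 0 ->
  (forall k, integralOver (intr : int -> C) (mu k)) ->
  (forall r, `|L 'X^r| <= (K * M.+1 ^ r)%:R) ->
  forall r, u r = 0.
Proof.
move=> d0 int_mu LX.
have /fin_all_exists2[p mon_p root_p] : forall k, exists2 p : {poly int},
    p \is monic & root (pZtoC p) (mu k).
  by move=> k; have [p mon_p rp] := int_mu k; exists p.
pose P := \prod_k p k.
have monP : P \is monic by rewrite monic_prod.
have rP k : root (pZtoC P) (mu k).
  by rewrite /P (bigD1 k) //= rmorphM rootM root_p.
have [n0 n0P] := hermite_eq0_small rP LX.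
have LP := hermite_eq0_ideal monP n0P; set n1 := maxn _ _ in LP.
have [rs PE] := closed_field_poly_normal (pZtoC P).
have lcP : lead_coef (pZtoC P) = 1.
  by rewrite lead_coef_map_inj ?(monicP monP) //; apply: intr_inj.
rewrite lcP scale1r in PE.
(* [P] may have repeated roots, while the descent needs a separable polynomial; [S] is its
   radical. *)
pose S := \prod_(z <- undup rs) ('X - z%:P).
have sepS : separable_poly S by rewrite separable_prod_XsubC undup_uniq.
have rS k : root S (mu k).
  by rewrite root_prod_XsubC mem_undup -root_prod_XsubC -PE.
(* Each of the [size rs] linear factors of [P] divides [S]. *)
have dvdS : pZtoC (P ^+ n1) %| S ^+ (size rs * n1).
  suff dvd_prod s : {subset s <= undup rs} ->
      \prod_(z <- s) ('X - z%:P) %| S ^+ size s.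
    rewrite rmorphXn /= exprM PE dvdp_exp2r // dvd_prod // => z.
    by rewrite mem_undup.
  elim: s => [|z s IHs] sub; first by rewrite big_nil dvd1p.
  rewrite big_cons exprS dvdp_mul ?IHs //.
    by rewrite dvdp_XsubCl root_prod_XsubC sub ?mem_head.
  by move=> y ys; rewrite sub // inE ys orbT.
have L0 : forall Q, L Q = 0.
  apply: (hermite_separable_descent _ sepS rS (n := size rs * n1)).
    by rewrite intr_eq0.
  by move=> Q; have [T ->] := dvdpP _ _ dvdS; rewrite mulrAC LP.
move=> r; have := hermite_rec c mu d%:~R 'X^r.
by rewrite !L0 mulr0 addr0 uE => /esym/eqP; rewrite intr_eq0 => /eqP.
Qed.

End IntegralHermite.

(** * Conjugates of the evaluation point *)

Module SymmetricInteger.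
From mathcomp Require Import perm mpoly.

Lemma mmap_mesym (C : idomainType) (n k : nat) (h : 'I_n -> C) :
  mmap (intr : int -> C) h (mesym n int k) = (mesym n C k).@[h].
Proof.
rewrite /mesym !raddf_sum /=; apply/eq_bigr => i _.
by rewrite !rmorph_prod /=; apply/eq_bigr => j _; rewrite mmapX mmap1U mevalXU.
Qed.

(** By the fundamental theorem [q] is an integer polynomial in the elementary symmetric ones, whose
    values are signed coefficients of [p] by Vieta. *)
Lemma mmap_symmetric_int (C : idomainType) (n : nat) (h : n.-tuple C)
    (p : {poly int}) (q : {mpoly int[n]}) :
  map_poly (intr : int -> C) p = \prod_(c <- h) ('X - c%:P) ->
  q \is symmetric ->
  exists z : int, mmap (intr : int -> C) (tnth h) q = z%:~R.
Proof.
move=> pE /sym_fundamental[t [<- _]].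
have sE (k : 'I_n.+1) :
    mmap (intr : int -> C) (tnth h) (mesym n int k) = ((-1) ^+ k * p`_(n - k))%:~R.
  rewrite mmap_mesym; have := mroots_coeff h k; rewrite -pE coef_map /= => pk.
  by rewrite rmorphM rmorph_sign /= pk mulrA -expr2 sqrr_sign mul1r.
rewrite comp_mpolyEX raddf_sum /=.
elim/big_ind: _ => [|x y [z1 ->] [z2 ->]|m _].
- by exists 0.
- by exists (z1 + z2); rewrite rmorphD.
rewrite mmapZ comp_mpolyX rmorph_prod /=.
exists (t@_m * \prod_(i < n) ((-1) ^+ (lift ord0 i) * p`_(n - (lift ord0 i))) ^+ m i).
rewrite rmorphM rmorph_prod; congr (_ * _); apply: eq_bigr => i _.
by rewrite !rmorphXn /= tnth_mktuple -(sE (lift ord0 i)).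
Qed.

(** The weight of [f] depends only on its fibre sizes, so permuting the variables merely permutes
    the functions [f]: the sum is a symmetric integer polynomial in the entries of [h]. *)
Lemma fibre_sum_int (C : idomainType) (n r : nat) (h : n.-tuple C)
    (p : {poly int}) (u : nat -> int) :
  map_poly (intr : int -> C) p = \prod_(c <- h) ('X - c%:P) ->
  exists z : int, z%:~R = \sum_(f : {ffun 'I_r -> 'I_n})
    (\prod_m u #|[set s | f s == m]|)%:~R * \prod_s tnth h (f s).
Proof.
move=> pE.
pose q : {mpoly int[n]} := \sum_(f : {ffun 'I_r -> 'I_n})
  (\prod_m u #|[set s | f s == m]|) *: \prod_s 'X_(f s).
have sym_q : q \is symmetric.
  apply/issymP => sg; rewrite /q raddf_sum /=.
  have inj_sg : injective (fun f : {ffun 'I_r -> 'I_n} => [ffun s => sg (f s)]).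
    move=> f g /ffunP fg; apply/ffunP => s.
    by have := fg s; rewrite !ffunE => /perm_inj.
  rewrite [RHS](reindex_inj inj_sg) /=; apply: eq_bigr => f _.
  rewrite msymZ rmorph_prod /=; congr (_ *: _).
    rewrite [RHS](reindex_inj (@perm_inj _ sg)) /=; apply: eq_bigr => m _.
    congr (u _); apply: eq_card => s.
    by rewrite !inE ffunE (inj_eq perm_inj).
  apply: eq_bigr => s _; rewrite ffunE msymX; congr 'X_[_].
  apply/mnmP => j; rewrite mnmE !mnm1E; congr (nat_of_bool _).
  by rewrite -(inj_eq (@perm_inj _ sg)) permKV.
have [z zE] := mmap_symmetric_int pE sym_q; exists z.
rewrite -zE /q raddf_sum /=; apply: eq_bigr => f _.
rewrite mmapZ !rmorph_prod /=; congr (_ * _); apply: eq_bigr => s _.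
by rewrite mmapX mmap1U.
Qed.
End SymmetricInteger.

(** * Spectral form of matrix powers *)

Lemma is_diag_mx_eq (K : fieldType) (n : nat) (B : 'M[K]_n) :
  is_diag_mx B -> B = diag_mx (\row_k B k k).
Proof.
move=> /is_diag_mxP dB; apply/matrixP => k l; rewrite !mxE.
by case: eqVneq => [->|ne]; rewrite ?mulr1n // mulr0n dB.
Qed.

(** The rows of the diagonalizing matrix are left eigenvectors, so the diagonal entries are
    eigenvalues. *)
Lemma diagonalizable_pow (K : fieldType) (n : nat) (A : 'M[K]_n.+1) :
  diagonalizable A ->
  exists (lam : 'I_n.+1 -> K) (Q W : 'M[K]_n.+1),
    (forall k, root (char_poly A) (lam k)) /\
    (forall r i j, (A ^+ r) i j = \sum_k Q i k * lam k ^+ r * W k j).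
Proof.
move=> [P Pu]; set B := conjmx P A => dB; pose lam k := B k k.
have PA : P *m A = diag_mx (\row_k lam k) *m P.
  by rewrite -(is_diag_mx_eq dB) /B conjumx // mulmxKV.
exists lam, (invmx P), P; split=> [k|r i j].
  rewrite -eigenvalue_root_char; apply/eigenvalueP; exists (row k P).
    by rewrite -row_mul PA mul_diag_mx; apply/rowP => l; rewrite !mxE.
  apply/eqP => rP0; move: Pu; rewrite -row_free_unit => /row_freeP[P' PP'].
  have := congr1 (row k) PP'; rewrite row_mul rP0 mul0mx => /rowP/(_ k).
  by rewrite !mxE eqxx => /esym/eqP; rewrite oner_eq0.
have -> : A ^+ r = invmx P *m diag_mx (\row_k lam k ^+ r) *m P.
  suff PAr : P *m A ^+ r = diag_mx (\row_k lam k ^+ r) *m P.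
    by rewrite -mulmxA -PAr mulKmx.
  elim: r => [|r IHr].
    rewrite expr0 mulmx1 (_ : diag_mx _ = 1%:M) ?mul1mx //.
    by apply/matrixP => k l; rewrite !mxE expr0.
  rewrite exprSr -[A ^+ r * A]/(A ^+ r *m A) mulmxA IHr -mulmxA PA mulmxA; congr (_ *m _).
  apply/matrixP => k l; rewrite mul_diag_mx !mxE.
  by case: eqVneq => [->|]; rewrite ?mulr1n ?mulr0n ?mulr0 // exprSr.
rewrite mxE; apply: eq_bigr => k _; rewrite mul_mx_diag !mxE.
by [].
Qed.

(** Multiplication by the leading coefficient makes [b] integral; the nonzero constant term keeps
    all conjugates nonzero. *)
Lemma monic_scaled_root (C : numClosedFieldType) (b : C) : b != 0 ->
  algebraicOver (ratr : rat -> C) b ->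
  exists (a : int) (p : {poly int}), [/\ a != 0, p \is monic, p`_0 != 0 &
    root (map_poly (intr : int -> C) p) (a%:~R * b)].
Proof.
move=> b0 [q0 q0n0 rq0].
(* Clear denominators, then cancel factors ['X], which do not vanish at [b]. *)
have [q [q00 rq]] : exists q : {poly int}, q`_0 != 0 /\ root (map_poly (intr : int -> C) q) b.
  have [q1 [a a0 q0E]] := rat_poly_scale q0.
  have : q1 != 0.
    by apply: contraNneq q0n0 => q10; rewrite q0E q10 rmorph0 scaler0.
  have : root (map_poly (intr : int -> C) q1) b.
    have /rootP := rq0; rewrite q0E map_polyZ /= -map_poly_comp /=.
    rewrite hornerZ => /eqP; rewrite mulf_eq0 fmorph_eq0 invr_eq0 intr_eq0 (negPf a0) /=.
    by rewrite (eq_map_poly (g := intr)) // => z /=; rewrite ratr_int.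
  elim/poly_ind: q1 {q0E} => [|q1 c IHq]; first by rewrite eqxx.
  have [->|c0] := eqVneq c 0; last first.
    by move=> rq _; exists (q1 * 'X + c%:P); rewrite coefD coefMX coefC add0r.
  rewrite polyC0 addr0 rmorphM /= map_polyX rootM rootX (negPf b0) orbF => rq1.
  by move=> q1X; apply: IHq => //; apply: contraNneq q1X => ->; rewrite mul0r.
have qn0 : q != 0 by apply: contraNneq q00 => ->; rewrite coef0.
have [e szq] : exists e, size q = e.+1.
  by exists (size q).-1; rewrite prednK // size_poly_gt0.
set a := lead_coef q; have a0 : a != 0 by rewrite lead_coef_eq0.
(* This is [a^(e-1) q(x/a)]; the top coefficient is set apart because its exponent [-1] would be
   truncated. *)
pose p := \poly_(i < e.+1) (if i == e then 1 else q`_i * a ^+ (e.-1 - i)).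
have szp : size p = e.+1 by rewrite size_poly_eq // eqxx oner_eq0.
exists a, p; split=> //.
- by rewrite monicE lead_coefE szp coef_poly ltnSn eqxx.
- rewrite coef_poly ltn0Sn. case: (0%N == e); first exact: oner_neq0.
  by rewrite mulf_neq0 // expf_neq0.
have aC0 : a%:~R != 0 :> C by rewrite intr_eq0.
rewrite /root -(mulrI_eq0 _ (mulfI aC0)); apply/eqP.
have -> : a%:~R * (map_poly intr p).[a%:~R * b] = a%:~R ^+ e * (map_poly intr q).[b] :> C.
  rewrite (@horner_coef_wide _ e.+1); last by rewrite -szp size_poly.
  rewrite (@horner_coef_wide _ e.+1 (map_poly _ q)); last by rewrite -szq size_poly.
  rewrite !mulr_sumr; apply: eq_bigr => i _.
  rewrite !coef_map /= coef_poly ltn_ord exprMn; case: eqP => [->|/eqP ne_ie].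
    by rewrite /a lead_coefE szq /=; ring.
  have lt_ie : (i < e)%N by rewrite ltn_neqAle ne_ie -ltnS ltn_ord.
  have -> : a%:~R ^+ e = a%:~R * a%:~R ^+ (e.-1 - i) * a%:~R ^+ i :> C.
    by rewrite -exprS -exprD; congr (_ ^+ _); lia.
  by rewrite rmorphM rmorphXn /=; ring.
by rewrite (rootP rq) mulr0.
Qed.

(** * Taylor coefficients of the product over conjugates *)

Section ConjugateProduct.
Variables (C : comNzRingType) (n d : nat) (c lam : 'I_n -> C) (gam : 'I_d -> C).
Variable u : nat -> int.
Hypothesis uE : forall r, \sum_k c k * lam k ^+ r = (u r)%:~R.

(** Both sides are the factorial of [#|T|] times the coefficient of [x^#|T|] in the product of the
    [f(gam m x)], computed from the exponents on the left and from the factor series on the right.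
    [T] will be ['I_r] and ['I_d * 'I_s]. *)
Lemma prod_exp_sum_coef (T : finType) :
  \sum_(k : {ffun 'I_d -> 'I_n})
     (\prod_m c (k m)) * (\sum_m gam m * lam (k m)) ^+ #|T| =
  \sum_(f : {ffun T -> 'I_d})
     (\prod_m u #|[set t | f t == m]|)%:~R * \prod_t gam (f t).
Proof.
(* Expand the power over functions [f]; once the sums are exchanged, the factors [lam] are grouped
   along the fibres of [f]. *)
transitivity (\sum_(k : {ffun 'I_d -> 'I_n}) \sum_(f : {ffun T -> 'I_d})
   (\prod_m c (k m)) * \prod_t (gam (f t) * lam (k (f t)))).
  apply: eq_bigr => k _; rewrite -mulr_sumr -(bigA_distr_bigA (fun _ m => gam m * lam (k m))).
  by rewrite prodr_const.
rewrite exchange_big /=; apply: eq_bigr => f _.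
under eq_bigr => k _ do rewrite big_split /= mulrCA mulrC.
rewrite -mulr_suml; congr (_ * _); rewrite rmorph_prod /=.
under [RHS]eq_bigr => m _ do rewrite -uE.
rewrite bigA_distr_bigA /=; apply: eq_bigr => k _.
rewrite (partition_big f xpredT) //= -big_split /=; apply: eq_bigr => m _.
rewrite (eq_bigr (fun=> lam (k m))) => [|t /eqP-> //].
by rewrite prodr_const; congr (_ * _ ^+ _); apply: eq_card => t; rewrite inE.
Qed.

End ConjugateProduct.

(* If [s] is minimal with [u s != 0], a product of [d] weights [u] with total
   index [d * s] is nonzero only when each index equals [s]. *)
Lemma fibre_sum_lowest_neq0 (C : numFieldType) (d s : nat) (gam : 'I_d -> C)
    (u : nat -> int) :
  (forall m, gam m != 0) -> u s != 0 -> (forall r, (r < s)%N -> u r = 0) ->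
  \sum_(f : {ffun 'I_d * 'I_s -> 'I_d})
    (\prod_m u #|[set t | f t == m]|)%:~R * \prod_t gam (f t) != 0.
Proof.
move=> gam0 us0 u_lt.
pose bal := [pred f : {ffun 'I_d * 'I_s -> 'I_d} | [forall m, s == #|[set t | f t == m]|]].
rewrite (bigID bal) /= [X in _ + X]big1 ?addr0; last first.
  move=> f not_bal; suff [m lt_ms] : exists m, (#|[set t | f t == m]| < s)%N.
    by rewrite (bigD1 m) //= u_lt // mul0r mul0r.
  apply/existsP; rewrite -[[exists _, _]]negbK negb_exists; apply: contra not_bal => /forallP ge_s.
  (* The fibre sizes add up to [d * s], so if none is below [s], all equal [s]. *)
  have le_s m (_ : true) : (s <= #|[set t | f t == m]| ?= iff (s == #|[set t | f t == m]|))%N.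
    by apply/leqifP; have := ge_s m; rewrite -leqNgt; case: ltngtP.
  have [_ eq_sum] := leqif_sum le_s.
  suff /forallP all_s : [forall (m | true), s == #|[set t | f t == m]|].
    by apply/forallP => m; apply: all_s.
  rewrite -eq_sum sum_nat_const card_ord.
  have -> : (\sum_m #|[set t | f t == m]| = #|{: 'I_d * 'I_s}|)%N.
    rewrite -sum1_card (partition_big f xpredT) //=; apply: eq_bigr => m _.
    by rewrite -sum1_card; apply: eq_bigl => t; rewrite inE.
  by rewrite card_prod !card_ord.
(* All balanced [f] contribute the same nonzero value, and the first projection is one of them; in
   characteristic zero the sum is nonzero. *)
rewrite (eq_bigr (fun=> (u s)%:~R ^+ d * \prod_m gam m ^+ s)) => [|f /forallP fP]; last first.
  congr (_ * _).
    rewrite rmorph_prod /= (eq_bigr (fun=> (u s)%:~R)) ?prodr_const ?card_ord //.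
    by move=> m _; rewrite -(eqP (fP m)).
  rewrite (partition_big f xpredT) //=; apply: eq_bigr => m _.
  rewrite (eq_bigr (fun=> gam m)) => [|t /eqP-> //]; rewrite prodr_const.
  congr (_ ^+ _); rewrite [RHS](eqP (fP m)); apply: eq_card => t.
  by rewrite inE.
rewrite sumr_const mulrn_eq0 negb_or; apply/andP; split.
  rewrite -lt0n; apply/card_gt0P; exists [ffun t => t.1].
  apply/forallP => m; apply/eqP.
  rewrite (_ : [set t | _] = setX [set m] setT) ?cardsX ?cards1 ?cardsT ?card_ord ?mul1n //.
  by apply/setP => t; rewrite !inE ffunE andbT.
rewrite mulf_neq0 ?expf_neq0 ?intr_eq0 //.
by apply/prodf_neq0 => m _; rewrite expf_neq0.
Qed.

From mathcomp Require Import all_classical all_reals.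
From mathcomp Require Import topology normedtype sequences exp.
From mathcomp Require Import complex.

Import numFieldNormedType.Exports.

Local Open Scope classical_set_scope.
Local Open Scope ring_scope.

(** * The complex exponential *)

Definition exp_sum (K : numFieldType) (N : nat) (z : K) : K :=
  \sum_(k < N) z ^+ k / k`!%:R.

Lemma exp_sumM (K : numFieldType) (N : nat) (x y : K) :
  exp_sum N x * exp_sum N y = exp_sum N (x + y) +
    \sum_(i < N) \sum_(j < N | (N <= i + j)%N)
      (x ^+ i / i`!%:R) * (y ^+ j / j`!%:R).
Proof.
have -> : exp_sum N (x + y) = \sum_(i < N) \sum_(j < N | (i + j < N)%N)
      (x ^+ i / i`!%:R) * (y ^+ j / j`!%:R).
  transitivity (\sum_(k < N) \sum_(i < N) \sum_(j < N | (i + j == k)%N)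
      (x ^+ i / i`!%:R) * (y ^+ j / j`!%:R)).
    apply: eq_bigr => k _; rewrite exprDn mulr_suml [RHS](exchange_big_dep xpredT) //=.
    rewrite (big_ord_widen N (fun i => (x ^+ (k - i) * y ^+ i *+ 'C(k, i)) / k`!%:R)) //.
    rewrite big_mkcond; apply: eq_bigr => j _; rewrite ltnS.
    case: leqP => [le_jk|lt_kj]; last first.
      by rewrite big1 // => i /eqP ijk; move: lt_kj; rewrite -ijk ltnNge leq_addl.
    have lt_N : (k - j < N)%N by apply: leq_ltn_trans (ltn_ord k); apply: leq_subr.
    rewrite (big_pred1 (Ordinal lt_N)) => [|i] /=; last first.
      by rewrite -val_eqE /=; apply/eqP/eqP => [<-|->]; rewrite ?addnK ?subnK.
    have fN0 m : m`!%:R != 0 :> K by rewrite pnatr_eq0 -lt0n fact_gt0.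
    rewrite -mulr_natr -(bin_fact le_jk) !natrM; field.
    by rewrite !fN0 pnatr_eq0 -lt0n bin_gt0 le_jk.
  rewrite exchange_big; apply: eq_bigr => i _ /=.
  under eq_bigr do rewrite big_mkcond /=.
  rewrite exchange_big [RHS]big_mkcond /=; apply: eq_bigr => j _.
  case: ltnP => [lt_N|le_N].
    rewrite (bigD1 (Ordinal lt_N)) //= eqxx big1 ?addr0 // => k ne_k.
    by case: eqP => // ijk; case/eqP: ne_k; apply: val_inj.
  by rewrite big1 // => k _; case: eqP => // ijk; move: (ltn_ord k); rewrite -ijk ltnNge le_N.
rewrite /exp_sum mulr_suml -big_split /=; apply: eq_bigr => i _.
rewrite mulr_sumr (bigID (fun j : 'I_N => (i + j < N)%N)) /=; congr (_ + _).
by apply: eq_bigl => j; rewrite -leqNgt.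
Qed.

(** The remainder in [exp_sumM] has nonnegative coefficients, so the triangle inequality bounds it
    by its value at [|x|] and [|y|]. *)
Lemma ler_exp_sumM (K : numFieldType) (N : nat) (x y : K) :
  `|exp_sum N x * exp_sum N y - exp_sum N (x + y)| <=
  exp_sum N `|x| * exp_sum N `|y| - exp_sum N (`|x| + `|y|).
Proof.
rewrite !exp_sumM ![_ + _ - _]addrAC !subrr !add0r.
apply: le_trans (ler_norm_sum _ _ _) _; apply: ler_sum => i _.
apply: le_trans (ler_norm_sum _ _ _) _; apply: ler_sum => j _.
by rewrite !normrM !normfV !normr_nat !normrX.
Qed.

(** The factorial of [N + k] is at least the product of those of [N] and [k]. *)
Lemma norm_exp_sumB (K : numFieldType) (N m : nat) (z : K) :
  `|exp_sum (N + m) z - exp_sum N z| <= `|z| ^+ N / N`!%:R * exp_sum m `|z|.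
Proof.
rewrite /exp_sum big_split_ord /= addrAC subrr add0r.
apply: le_trans (ler_norm_sum _ _ _) _; rewrite mulr_sumr; apply: ler_sum => k _.
rewrite normrM normfV normr_nat normrX exprD mulrACA ler_wpM2l ?mulr_ge0 ?exprn_ge0 //.
rewrite -invfM -natrM lef_pV2 ?posrE ?ltr0n ?muln_gt0 ?fact_gt0 // ler_nat.
rewrite -(bin_fact (leq_addr k N)) addKn.
by rewrite leq_pmull // bin_gt0 leq_addr.
Qed.

Section ComplexExp.
Variable R : realType.
Local Notation C := (R[i] : numFieldType).
Implicit Types z w : C.

Lemma cvg_real_complex (f : nat -> R) (l : R) :
  f @ \oo --> l -> (fun N => ((f N)%:C)%C : C) @ \oo --> ((l%:C)%C : C).
Proof.
move=> fl; apply/cvgrPdist_lt => e e0.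
have /complex_realP[e' eE] : e \is Num.real by rewrite gtr0_real.
move: e0; rewrite eE ltcR => e0.
move/cvgrPdist_lt : fl => /(_ _ e0); apply: filterS => N.
by rewrite -rmorphB normc_def /= expr0n /= addr0 sqrtr_sqr ltcR.
Qed.

Lemma exp_sum_real (N : nat) (x : R) :
  exp_sum N ((x%:C)%C : C) = ((exp_sum N x)%:C)%C.
Proof.
rewrite /exp_sum rmorph_sum; apply: eq_bigr => k _.
by rewrite rmorphM rmorphXn fmorphV rmorph_nat.
Qed.

Lemma cvg_exp_sum_real (x : R) : (fun N => exp_sum N x) @ \oo --> expR x.
Proof.
rewrite (_ : (fun N => _) = series (exp_coeff x)); first exact: is_cvg_series_exp_coeff.
by apply/funext => N; rewrite /series /= big_mkord.
Qed.

(** Real and imaginary parts are real series dominated by the exponential series at [|z|]. *)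
Lemma is_cvg_exp_sum (z : C) : cvgn (fun N => exp_sum N z).
Proof.
have [x xE] : exists x : R, `|z| = (x%:C)%C.
  by exists (Num.sqrt (complex.Re z ^+ 2 + complex.Im z ^+ 2)); rewrite normc_def.
have bound (g : C -> R) : (forall w, (`|g w|%:C)%C <= `|w|) ->
    cvgn (series (fun k => g (z ^+ k / k`!%:R))).
  move=> gle; apply: normed_cvg; apply: (@series_le_cvg _ _ (exp_coeff x)) => [k|k|k|].
  - by rewrite /= normr_ge0.
  - by rewrite exp_coeff_ge0 // -ler0c -xE.
  - rewrite /= -lecR (le_trans (gle _)) // normrM normfV normr_nat normrX xE.
    by rewrite /exp_coeff /= rmorphM rmorphXn fmorphV rmorph_nat.
  - exact: is_cvg_series_exp_coeff.
have cvRe := bound (@complex.Re R) (@normc_ge_Re R).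
have cvIm : cvgn (series (fun k => complex.Im (z ^+ k / k`!%:R))).
  apply: bound => w; rewrite normc_def lecR -sqrtr_sqr ler_wsqrtr //.
  by rewrite lerDr sqr_ge0.
have exp_sumE N : exp_sum N z =
    ((series (fun k => complex.Re (z ^+ k / k`!%:R)) N)%:C)%C +
    'i%C * ((series (fun k => complex.Im (z ^+ k / k`!%:R)) N)%:C)%C :> C.
  have ReD : {morph @complex.Re R : x y / x + y} by move=> [? ?] [? ?].
  have ImD : {morph @complex.Im R : x y / x + y} by move=> [? ?] [? ?].
  rewrite [LHS]complexE /series /= !big_mkord /exp_sum.
  by rewrite (big_morph _ ReD (erefl _)) (big_morph _ ImD (erefl _)).
apply/cvg_ex; eexists; rewrite (funext exp_sumE).
apply: cvgD (cvg_real_complex cvRe) (cvgM (cvg_cst ('i%C : C)) (cvg_real_complex cvIm)).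
Qed.

Definition cexp z : C := limn (fun N => exp_sum N z).

Lemma cvg_cexp z : (fun N => exp_sum N z) @ \oo --> cexp z.
Proof. exact: is_cvg_exp_sum. Qed.

Lemma cexp0 : cexp 0 = 1.
Proof.
apply: cvg_lim; first exact: norm_hausdorff.
(* [exp_sum 0 0] is an empty sum, so the value [1] is reached only from index [1] on. *)
rewrite -cvg_shiftS; apply: cvg_near_cst; near=> N.
rewrite /exp_sum /= big_ord_recl expr0 fact0 divr1 big1 ?addr0 // => i _.
by rewrite lift0 expr0n mul0r.
Unshelve. all: by end_near. Qed.

(** The defect of the partial sums is bounded by the same defect at [|z|] and [|w|], which tends to
    [0] by the real addition theorem. *)
Lemma cexpD z w : cexp (z + w) = cexp z * cexp w.
Proof.
have [x xE] : exists x : R, `|z| = (x%:C)%C by exists (complex.Re `|z|); rewrite RRe_real ?normr_real.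
have [y yE] : exists y : R, `|w| = (y%:C)%C by exists (complex.Re `|w|); rewrite RRe_real ?normr_real.
have cvl : (fun N => exp_sum N z * exp_sum N w - exp_sum N (z + w)) @ \oo -->
    cexp z * cexp w - cexp (z + w).
  exact: (cvgB (cvgM (@cvg_cexp z) (@cvg_cexp w)) (@cvg_cexp (z + w))).
have cvr : (fun N => exp_sum N `|z| * exp_sum N `|w| - exp_sum N (`|z| + `|w|)) @ \oo
    --> (0 : C).
  rewrite xE yE.
  have -> : (0 : C) = ((expR x * expR y - expR (x + y))%:C)%C by rewrite expRD subrr.
  rewrite (_ : (fun N => _) = (fun N => ((exp_sum N x * exp_sum N y - exp_sum N (x + y))%:C)%C)).
    apply: cvg_real_complex; apply: cvgB; [apply: cvgM|]; exact: cvg_exp_sum_real.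
  by apply/funext => N; rewrite -rmorphD !exp_sum_real rmorphB rmorphM.
have cvl0 : (fun N => exp_sum N z * exp_sum N w - exp_sum N (z + w)) @ \oo --> (0 : C).
  apply/cvgr0Pnorm_lt => e e0; move/cvgr0Pnorm_lt : cvr => /(_ _ e0).
  apply: filterS => N; apply: le_lt_trans; rewrite [X in _ <= X]ger0_norm ?ler_exp_sumM //.
  exact: le_trans (normr_ge0 _) (ler_exp_sumM _ _ _).
apply/esym/eqP; rewrite -subr_eq0; apply/eqP.
exact: cvg_unique cvl cvl0.
Qed.

Lemma cexp_sum (I : finType) (F : I -> C) : cexp (\sum_i F i) = \prod_i cexp (F i).
Proof. exact: (big_morph _ cexpD cexp0). Qed.

Lemma exp_sum_bounded z : exists K : nat, forall N, exp_sum N `|z| <= K%:R :> C.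
Proof.
have [x xE] : exists x : R, `|z| = (x%:C)%C by exists (complex.Re `|z|); rewrite RRe_real ?normr_real.
have x0 : 0 <= x by rewrite -ler0c -xE.
exists (Num.truncn (expR x)).+1 => N.
rewrite xE exp_sum_real -(rmorph_nat (real_complex R)) lecR.
apply: le_trans (ltW (truncnS_gt _)).
rewrite (_ : exp_sum N x = series (exp_coeff x) N); last first.
  by rewrite /series /= big_mkord.
apply: nondecreasing_cvgn_le (is_cvg_series_exp_coeff x) _ => m1 m2 le_m.
rewrite /series /= [X in _ <= X](big_cat_nat (n := m1)) //=.
by rewrite lerDl sumr_ge0 // => k _; apply: exp_coeff_ge0.
Qed.

Lemma cexp_tail z : exists K : nat, forall N,
  `|cexp z - exp_sum N z| <= `|z| ^+ N / N`!%:R * K%:R.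
Proof.
have [K expK] := exp_sum_bounded z; exists K => N.
set b := _ * K%:R; have b0 : 0 <= b by rewrite mulr_ge0 ?divr_ge0 ?exprn_ge0.
(* Otherwise some partial sum beyond [N] is closer to the limit than the excess over [b], against
   [norm_exp_sumB]. *)
rewrite real_leNgt ?ger0_real //; apply/negP => lt_b.
move: (@cvg_cexp z) => /cvgrPdist_lt /(_ (`|cexp z - exp_sum N z| - b)).
rewrite subr_gt0 lt_b => /(_ isT)[M _ /(_ (N + M)%N (leq_addl _ _))] /=.
apply/negP; rewrite -real_leNgt ?ger0_real ?subr_ge0 ?(ltW lt_b) //.
rewrite lerBlDr -(subrKA (exp_sum (N + M) z) (cexp z)).
apply: le_trans (ler_normD _ _) _; rewrite lerD2l.
apply: le_trans (norm_exp_sumB _ _ _) _; rewrite ler_wpM2l ?divr_ge0 ?exprn_ge0 //.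
exact: expK.
Qed.

End ComplexExp.

(** * Vanishing of exponential sums at algebraic points *)

Lemma exp_evalXn (C : numClosedFieldType) (I : finType) (c mu : I -> C) (r : nat) :
  exp_eval c mu 'X^r = \sum_k c k * mu k ^+ r.
Proof. by rewrite /exp_eval; apply: eq_bigr => k _; rewrite hornerXn. Qed.

(** This links [L] to the exponential: when the full exponential sum vanishes, only its tail is
    left. *)
Lemma hermiteXn (C : numClosedFieldType) (I : finType) (c mu : I -> C) (D : C) (r : nat) :
  D != 0 ->
  hermite c mu D 'X^r = r`!%:R * D ^+ r * \sum_k c k * exp_sum r.+1 (mu k / D).
Proof.
move=> D0; have fact0n m : m`!%:R != 0 :> C by rewrite pnatr_eq0 -lt0n fact_gt0.
have exp_evalE m : exp_eval c mu 'X^m =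
    m`!%:R * D ^+ m * \sum_k c k * ((mu k / D) ^+ m / m`!%:R).
  rewrite exp_evalXn mulr_sumr; apply: eq_bigr => k _; rewrite exprMn exprVn.
  by field; rewrite fact0n expf_neq0.
have exp_sumS m z : exp_sum m.+1 z = exp_sum m z + z ^+ m / m`!%:R :> C.
  by rewrite /exp_sum big_ord_recr.
elim: r => [|r IHr].
  rewrite hermite_rec derivXn mulr0n linear0 mulr0 addr0 exp_evalE.
  congr (_ * _); apply: eq_bigr => k _; rewrite exp_sumS /exp_sum big_ord0 add0r.
  by [].
rewrite hermite_rec derivXn linearMn /= IHr exp_evalE.
under [in RHS]eq_bigr => k _ do rewrite exp_sumS mulrDr.
rewrite big_split /= mulrDr addrC; congr (_ + _).
by rewrite factS natrM exprS -mulr_natl; ring.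
Qed.

Section Complex.
Variable R : realType.
Local Notation C := (R[i] : numFieldType).

Lemma le_nat_complex (a : C) : 0 <= a -> exists N : nat, a <= N%:R.
Proof.
move=> a0; have aE : ((complex.Re a)%:C)%C = a by rewrite RRe_real ?ger0_real.
exists (Num.truncn (complex.Re a)).+1.
by rewrite -aE -(rmorph_nat (real_complex R)) lecR ltW ?truncnS_gt.
Qed.

Lemma hermiteXn_bound (I : finType) (c mu : I -> R[i]) (D : R[i]) : D != 0 ->
  \sum_k c k * cexp (mu k / D) = 0 ->
  exists K M : nat, forall r, `|hermite c mu D 'X^r| <= (K * M.+1 ^ r)%:R.
Proof.
move=> D0 sum0.
have [Kz KzP] := choice (fun k => cexp_tail (mu k / D)).
have [K KP] : exists K : nat, \sum_k `|c k| * `|mu k / D| * (Kz k)%:R <= K%:R :> R[i].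
  by apply: le_nat_complex; apply: sumr_ge0 => k _; rewrite !mulr_ge0.
have [M MP] : exists M : nat, \sum_k `|D| * `|mu k / D| <= M%:R :> R[i].
  by apply: le_nat_complex; apply: sumr_ge0 => k _; rewrite !mulr_ge0.
exists K, M => r; rewrite hermiteXn //.
(* The full sum is zero, so the partial sums are minus the tails. *)
have -> : \sum_k c k * exp_sum r.+1 (mu k / D) =
    - \sum_k c k * (cexp (mu k / D) - exp_sum r.+1 (mu k / D)).
  by under [X in - X]eq_bigr do rewrite mulrBr; rewrite sumrB sum0 sub0r opprK.
rewrite mulrN normrN natrM natrX.
apply: le_trans (ler_wpM2r _ KP); last by rewrite exprn_ge0.
rewrite mulr_sumr mulr_suml; apply: le_trans (ler_norm_sum _ _ _) _.
apply: ler_sum => k _; move: (KzP k) MP => /=; set z := mu k / D => KzPk MP.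
rewrite [leLHS]normrM [X in X * _ <= _]normrM normr_nat normrX [X in _ * X <= _]normrM.
have le_M : `|D| * `|z| <= M.+1%:R.
  apply: le_trans (_ : M%:R <= _); last by rewrite ler_nat.
  apply: le_trans MP; rewrite (bigD1 k) //= -/z lerDl.
  by apply: sumr_ge0 => j _; rewrite mulr_ge0.
have := lerXn2r r _ _ le_M; rewrite !nnegrE mulr_ge0 // ler0n => /(_ isT isT) le_Mr.
apply: (@le_trans _ _ (r`!%:R * `|D| ^+ r * (`|c k| *
   (`|z| ^+ r.+1 / (r.+1)`!%:R * (Kz k)%:R)))).
  by rewrite ler_wpM2l ?mulr_ge0 ?exprn_ge0 // ler_wpM2l // KzP.
(* The factorials of [r] and [r.+1] cancel up to [1 / (r + 1)], which is at most [1]. *)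
have -> : r`!%:R * `|D| ^+ r * (`|c k| *
   (`|z| ^+ r.+1 / (r.+1)`!%:R * (Kz k)%:R)) =
   `|c k| * `|z| * (Kz k)%:R * (`|D| * `|z|) ^+ r * (r.+1)%:R^-1.
  rewrite factS natrM exprMn exprS; field.
  by rewrite pnatr_eq0 -lt0n fact_gt0 andbT nat1r pnatr_eq0.
rewrite -[leRHS]mulr1; apply: ler_pM.
- by rewrite !mulr_ge0 ?exprn_ge0 ?mulr_ge0.
- by rewrite invr_ge0.
- by apply: ler_wpM2l => //; rewrite !mulr_ge0.
- by rewrite invf_le1 ?ltr0n // ler1n.
Qed.

Lemma exp_sum_algebraic_eq0 (n : nat) (c lam : 'I_n -> R[i]) (u : nat -> int)
    (beta : R[i]) :
  (forall r, \sum_k c k * lam k ^+ r = (u r)%:~R) ->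
  (forall k, integralOver (intr : int -> R[i]) (lam k)) ->
  beta != 0 -> algebraicOver (ratr : rat -> R[i]) beta ->
  \sum_k c k * cexp (beta * lam k) = 0 -> forall r, u r = 0.
Proof.
move=> uE int_lam b0 alg_b sum0.
have [a [p [a0 mon_p p00 root_p]]] := monic_scaled_root b0 alg_b.
(* All roots are listed with multiplicity, so their symmetric functions are integers. *)
have [rs pE] := closed_field_poly_normal (map_poly (intr : int -> R[i]) p).
rewrite lead_coef_map_inj ?(monicP mon_p) ?scale1r in pE; [|exact: intr_inj|by []].
set d := size rs; pose gam (m : 'I_d) := tnth (in_tuple rs) m.
have root_gam m : root (map_poly (intr : int -> R[i]) p) (gam m).
  by rewrite pE root_prod_XsubC mem_tnth.
have gam0 m : gam m != 0.
  apply: contraNneq p00 => g0; have := root_gam m.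
  by rewrite g0 /root horner_coef0 coef_map /= intr_eq0.
have [m0 gam_m0] : exists m, gam m = a%:~R * beta.
  have : a%:~R * beta \in in_tuple rs by rewrite -root_prod_XsubC -pE.
  by case/tnthP => m ->; exists m.
pose I := {ffun 'I_d -> 'I_n}.
pose cI (k : I) := \prod_m c (k m); pose muI (k : I) := \sum_m gam m * lam (k m).
have /choice[U UE] r := SymmetricInteger.fibre_sum_int r u (h := in_tuple rs) pE.
have UcE r : exp_eval cI muI 'X^r = (U r)%:~R.
  have := prod_exp_sum_coef gam uE ('I_r : finType).
  by rewrite exp_evalXn UE card_ord => ->.
have int_mu k : integralOver (intr : int -> R[i]) (muI k).
  apply: (big_ind (integralOver intr)) => [||m _].
  - exact: integral0.
  - exact: integral_add.
  - by apply: integral_mul => //; exists p.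
have aC0 : a%:~R != 0 :> R[i] by rewrite intr_eq0.
(* This is [F(1/a) = 0]: the factor at [m0] is the given relation, since [gam m0 / a = beta]. *)
have sumI0 : \sum_k cI k * cexp (muI k / a%:~R) = 0.
  transitivity (\prod_m \sum_k c k * cexp (gam m * lam k / a%:~R)).
    rewrite bigA_distr_bigA; apply: eq_bigr => k _; rewrite big_split /=; congr (_ * _).
    by rewrite mulr_suml cexp_sum.
  apply/eqP/prodf_eq0; exists m0 => //; rewrite -[X in _ == X]sum0; apply/eqP.
  apply: eq_bigr => k _; congr (_ * cexp _).
  by rewrite gam_m0 mulrC !mulrA mulVf // mul1r.
have [K [M KM]] := hermiteXn_bound aC0 sumI0.
have U0 := integral_exp_coef_eq0 UcE a0 int_mu KM.
apply: contrapT => /existsNP[r0 /eqP ur0].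
(* With [s] the least index where [u] is nonzero, the coefficient of index [d * s] in the product is
   nonzero, against [U = 0]. *)
have [s us0 s_min] := ex_minnP (ex_intro (fun r => u r != 0) r0 ur0).
have u_lt r : (r < s)%N -> u r = 0.
  by move=> lt_rs; apply/eqP; apply: contraTT lt_rs => /s_min; rewrite -leqNgt.
have := fibre_sum_lowest_neq0 gam0 us0 u_lt.
rewrite -(prod_exp_sum_coef gam uE) -[X in X != 0](exp_evalXn cI muI).
by rewrite UcE U0 eqxx.
Qed.

(** * Matrix exponential and integrality of adjacency powers *)

(** There are finitely many entries, so entrywise convergence gives convergence in the sup norm;
    coordinates being continuous, uniqueness of limits in [C] identifies [expmx M]. *)
Lemma expmx_lim (n : nat) (M B : 'M[R[i]]_n) :
  (forall i j, (fun N => (\sum_(k < N) (k`!%:R)^-1 *: M ^+ k) i j : C) @ \oo -->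
    (B i j : C)) ->
  expmx M = B.
Proof.
move=> cvB; have SE N : series (fun k : nat => (k`!%:R)^-1 *: M ^+ k) N =
    \sum_(k < N) (k`!%:R)^-1 *: M ^+ k by rewrite /series /= big_mkord.
have cvM : series (fun k : nat => (k`!%:R)^-1 *: M ^+ k) @ \oo --> (B : 'M[C]_n).
  apply/cvg_ballP => e e0.
  have : \forall N \near \oo, forall i j,
      ball (B i j : C) e ((\sum_(k < N) (k`!%:R)^-1 *: M ^+ k) i j : C).
    apply: filter_forall => i; apply: filter_forall => j.
    by have /cvg_ballP/(_ e e0) := cvB i j.
  by apply: filterS => N ballN; split => // i j; rewrite SE.
apply/matrixP => i j.
have cvL : (fun N => (\sum_(k < N) (k`!%:R)^-1 *: M ^+ k) i j : C) @ \oo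
    --> (expmx M i j : C).
  rewrite (_ : (fun N => _) = (fun X : 'M[C]_n => X i j) \o
    series (fun k : nat => (k`!%:R)^-1 *: M ^+ k)).
    apply: continuous_cvg; first exact: coord_continuous.
    exact: cvgP cvM.
  by apply/funext => N /=; rewrite SE.
exact: cvg_unique cvL (cvB i j).
Qed.

Lemma expmx_diagonalizable (n : nat) (A : 'M[R[i]]_n) (beta : R[i]) (I : finType)
    (lam : I -> R[i]) (Q : 'I_n -> I -> R[i]) (W : I -> 'I_n -> R[i]) :
  (forall r i j, (A ^+ r) i j = \sum_k Q i k * lam k ^+ r * W k j) ->
  forall i j, expmx (beta *: A) i j = \sum_k Q i k * cexp (beta * lam k) * W k j.
Proof.
move=> powE i j.
rewrite (@expmx_lim _ _ (\matrix_(i, j) \sum_k Q i k * cexp (beta * lam k) * W k j)) ?mxE //.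
move=> {}i {}j; rewrite mxE.
have -> : (fun N => (\sum_(k < N) (k`!%:R)^-1 *: (beta *: A) ^+ k) i j : C) =
    (fun N => \sum_k Q i k * exp_sum N (beta * lam k) * W k j).
  apply/funext => N; rewrite summxE /exp_sum.
  under [RHS]eq_bigr do rewrite mulr_sumr mulr_suml.
  rewrite exchange_big /=; apply: eq_bigr => r _.
  have -> : (beta *: A) ^+ r = beta ^+ r *: A ^+ r.
    elim: (r : nat) => [|m IHm]; first by rewrite !expr0 scale1r.
    rewrite !exprS IHm -[_ * _]/(_ *m _) -scalemxAl -scalemxAr scalerA.
    by rewrite -exprS.
  rewrite !mxE powE !mulr_sumr; apply: eq_bigr => k _.
  by rewrite exprMn; ring.
apply: (@cvg_big C) => [|k _]; first exact: add_continuous.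
apply: cvgM; last exact: cvg_cst.
by apply: cvgM; [exact: cvg_cst | exact: cvg_cexp].
Qed.

(** This makes the differences [u] integers and, for [r = 1], the eigenvalues roots of a monic
    integer polynomial. *)
Lemma adjmx_pow_int (n : nat) (e : rel 'I_n.+1) (r : nat) :
  adjmx R[i] e ^+ r =
  map_mx (intr : int -> R[i]) ((\matrix_(i, j) (e i j)%:R : 'M[int]_n.+1) ^+ r).
Proof.
rewrite rmorphXn /=; congr (_ ^+ r); apply/matrixP => i j.
by rewrite !mxE rmorph_nat.
Qed.
End Complex.

Theorem theorem4p1 (R : realType) (n : nat) (e : rel 'I_n) (beta : R[i])
    (i j : 'I_n) :
  diagonalizable (adjmx R[i] e) ->
  beta != 0 ->
  algebraicOver (ratr : rat -> R[i]) beta ->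
  subgraph_equivalent beta (adjmx R[i] e) i j ->
  cospectral (adjmx R[i] e) i j.
Proof.
case: n => [|n] in e i j *; first by case: i.
move=> /diagonalizable_pow[lam [Q [W [root_lam powE]]]] b0 alg_b equiv r _.
pose B : 'M[int]_n.+1 := \matrix_(i, j) (e i j)%:R.
(* With these weights, the [i]-[i] entry minus the [j]-[j] entry is the sum of [c k * f(lam k)], for
   powers of the matrix and for its exponential alike. *)
pose c k := Q i k * W k i - Q j k * W k j.
have subE f : \sum_k Q i k * f k * W k i - \sum_k Q j k * f k * W k j =
    \sum_k c k * f k.
  by rewrite -sumrB; apply: eq_bigr => k _; rewrite /c; ring.
have uE m : \sum_k c k * lam k ^+ m = ((B ^+ m) i i - (B ^+ m) j j)%:~R.
  by rewrite -subE -!powE adjmx_pow_int rmorphB /= !mxE.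
have int_lam k : integralOver (intr : int -> R[i]) (lam k).
  exists (char_poly B); first exact: char_poly_monic.
  rewrite map_char_poly /= (_ : map_mx _ B = adjmx R[i] e) //.
  by have := adjmx_pow_int R e 1; rewrite !expr1.
have sum0 : \sum_k c k * cexp (beta * lam k) = 0.
  rewrite -subE -!(expmx_diagonalizable beta powE).
  by rewrite equiv subrr.
have := exp_sum_algebraic_eq0 uE int_lam b0 alg_b sum0 r.
by move=> u0; apply/eqP; rewrite -subr_eq0 !powE subE uE u0.
Qed.
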